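(* Let $Q_n$ and $\Phi_n=Q_{n-1}/Q_n-2$ be the polynomials and rational functions defined in the context, with $\mathrm{Dom}(\Phi_n)=\mathbb R^n\setminus\{Q_n=0\}$. Define $D_1^{(1)}=(-\infty,-1)$, $D_0^{(1)}=(-1,\infty)$, and inductively for $n\ge 1$: - $D_0^{(n+1)}$ is the epigraph of $\Phi_n$ restricted to $D_0^{(n)}$; - for $k=1,\dots,n$, $D_k^{(n+1)}$ is the hypograph of $\Phi_n$ restricted to $D_{k-1}^{(n)}$ joined together with the epigraph of $\Phi_n$ restricted to $D_k^{(n)}$ along their shared boundary, that is, $$D_k^{(n+1)}=\mathrm{hypo}(\Phi_n|_{D_{k-1}^{(n)}})\cup\big(\Gamma_{k-1}^{(n-1)}\times\mathbb R\big)\cup\mathrm{epi}(\Phi_n|_{D_k^{(n)}});$$ - $D_{n+1}^{(n+1)}$ is the hypograph of $\Phi_n$ restricted to $D_n^{(n)}$. Then for every $n\ge1$ the domain of $\Phi_n$ decomposes into $n+1$ unbounded connected components, namely $$\mathrm{Dom}(\Phi_n)=\bigcup_{k=0}^n D_k^{(n)},$$ where $D_0^{(n)},\dots,D_n^{(n)}$ are the (pairwise distinct) connected components of $\mathrm{Dom}(\Phi_n)$ and each of them is unbounded.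
   Context: The real polynomials $Q_n=Q_n(\mu_1,\dots,\mu_n)$ are defined by $Q_0=1$, $Q_1(\mu_1)=1+\mu_1$, and $Q_{n+1}=(2+\mu_{n+1})Q_n-Q_{n-1}$ for $n\ge1$. For $n\ge 1$, $\Phi_n(\mu_1,\dots,\mu_n)=\dfrac{Q_{n-1}(\mu_1,\dots,\mu_{n-1})}{Q_n(\mu_1,\dots,\mu_n)}-2$, with domain $\mathrm{Dom}(\Phi_n)=\{\mu\in\mathbb R^n: Q_n(\mu)\neq0\}$. For a real function $f$ the (open) epigraph and hypograph are $\mathrm{epi}(f)=\{(x,y)\in\mathrm{Dom}(f)\times\mathbb R: y>f(x)\}$ and $\mathrm{hypo}(f)=\{(x,y)\in\mathrm{Dom}(f)\times\mathbb R: y<f(x)\}$. For $n\ge1$ and $0\le k\le n$, $\Gamma_k^{(n)}\subset\mathbb R^{n+1}$ denotes the graph of $\Phi_n$ restricted to $D_k^{(n)}$; and $\Gamma_0^{(0)}=\{-1\}\subset\mathbb R$. *)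

(* Defs.v *)
From HB Require Import structures.
From mathcomp Require Import all_boot all_order all_algebra.
From mathcomp Require Import all_classical all_reals all_analysis.

Set Implicit Arguments.
Unset Strict Implicit.
Unset Printing Implicit Defensive.

Import Order.TTheory GRing.Theory Num.Theory.
Import numFieldNormedType.Exports.

Local Open Scope classical_set_scope.
Local Open Scope ring_scope.

(* A point of R^{n+1} is identified with the pair (rinit z, rlast z) in
   R^n x R. *)
Definition rinit (R : Type) (n : nat) (z : 'rV[R]_n.+1) : 'rV[R]_n :=
  \row_(i < n) z 0 (widen_ord (leqnSn n) i).

Definition rlast (R : Type) (n : nat) (z : 'rV[R]_n.+1) : R := z 0 ord_max.

(* Real functions of n real variables with an explicit domain; the values of
   pval outside pdom are irrelevant. *)
Record pfun (R : realType) (n : nat) := PFun {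
  pdom : set 'rV[R]_n;
  pval : 'rV[R]_n -> R }.

Definition prestrict (R : realType) (n : nat) (f : pfun R n)
    (A : set 'rV[R]_n) : pfun R n :=
  PFun (pdom f `&` A) (pval f).

Definition epi (R : realType) (n : nat) (f : pfun R n) : set 'rV[R]_n.+1 :=
  [set z | pdom f (rinit z) /\ rlast z > pval f (rinit z)].

Definition hypo (R : realType) (n : nat) (f : pfun R n) : set 'rV[R]_n.+1 :=
  [set z | pdom f (rinit z) /\ rlast z < pval f (rinit z)].

Definition pgraph (R : realType) (n : nat) (f : pfun R n) : set 'rV[R]_n.+1 :=
  [set z | pdom f (rinit z) /\ rlast z = pval f (rinit z)].

(* A x R *)
Definition cylinder (R : realType) (n : nat) (A : set 'rV[R]_n) :
    set 'rV[R]_n.+1 :=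
  [set z | A (rinit z)].

Fixpoint Q (R : realType) (n : nat) : 'rV[R]_n -> R :=
  match n return 'rV[R]_n -> R with
  | 0 => fun _ => 1
  | m.+1 =>
    match m return ('rV[R]_m -> R) -> 'rV[R]_m.+1 -> R with
    | 0 => fun _ mu => 1 + mu 0 0
    | p.+1 => fun Qm mu =>
        (2 + rlast mu) * Qm (rinit mu) - @Q R p (rinit (rinit mu))
    end (@Q R m)
  end.

(* Only n >= 1 is meaningful: Phi R 0 has empty domain. *)
Definition Phi (R : realType) (n : nat) : pfun R n :=
  match n return pfun R n with
  | 0 => PFun set0 (fun _ => 0)
  | m.+1 => PFun [set mu | Q mu != 0] (fun mu => Q (rinit mu) / Q mu - 2)
  end.

(* Gamma_k^{(n)}, given the family (D_k^{(n)})_k as Dn. *)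
Definition Gamma_of (R : realType) (n : nat) :
    (nat -> set 'rV[R]_n) -> nat -> set 'rV[R]_n.+1 :=
  match n return (nat -> set 'rV[R]_n) -> nat -> set 'rV[R]_n.+1 with
  | 0 => fun _ k => if k == 0%N then [set x | x 0 0 = -1] else set0
  | m.+1 => fun Dn k => pgraph (prestrict (Phi R m.+1) (Dn k))
  end.

(* D R n k is D_k^{(n)} for n >= 1 and k <= n, and the empty set otherwise. *)
Fixpoint D (R : realType) (n : nat) : nat -> set 'rV[R]_n :=
  match n return nat -> set 'rV[R]_n with
  | 0 => fun _ => set0
  | m.+1 =>
    match m return (nat -> set 'rV[R]_m) -> nat -> set 'rV[R]_m.+1 with
    | 0 => fun _ k =>
        if k == 0%N then [set x | x 0 0 > -1]
        else if k == 1%N then [set x | x 0 0 < -1]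
        else set0
    | p.+1 => fun Dm k =>
        if k == 0%N then epi (prestrict (Phi R p.+1) (Dm 0%N))
        else if (k <= p.+1)%N then
          hypo (prestrict (Phi R p.+1) (Dm k.-1))
          `|` cylinder (Gamma_of (@D R p) k.-1)
          `|` epi (prestrict (Phi R p.+1) (Dm k))
        else if k == p.+2 then hypo (prestrict (Phi R p.+1) (Dm p.+1))
        else set0
    end (@D R m)
  end.
Arguments D : clear implicits.

Definition connected_components (T : topologicalType) (A : set T) :
    set (set T) :=
  connected_component A @` A.

Definition unbounded (R : realType) (n : nat) (A : set 'rV[R]_n) : Prop :=
  ~ bounded_set A.

(* Main.v *)
(* D_k^(n) is the set of mu with Q_n(mu) <> 0 for which the sequence
   Q_0, ..., Q_n has exactly k sign changes, so these sets are disjoint and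
   cover Dom Phi_n. Sign changes are counted along
   Q_(n+1) = Q_n * (mu_(n+1) - Phi_n); and if Q_(n+2) Q_n < 0, there is exactly
   one change from Q_n to Q_(n+2) whatever the sign of Q_(n+1), including zero.
   Hence D_(k+1)^(n+2) is the union of the hypograph over D_k^(n+1), the
   epigraph over D_(k+1)^(n+1) and the open set {Q_(n+2) Q_n < 0} over
   D_k^(n), which contains the joining cylinder and meets both other pieces.
   Each piece is an open set fibred in star-shaped sets over a set that is
   open and connected by induction, so D_(k+1)^(n+2) is open and connected. *)
Require Import Defs.
From mathcomp Require Import all_boot all_order all_algebra.
From mathcomp Require Import all_classical all_reals all_analysis.
From mathcomp Require Import ring lra.

Set Implicit Arguments.
Unset Strict Implicit.
Unset Printing Implicit Defensive.

Import Order.TTheory GRing.Theory Num.Theory.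
Import numFieldNormedType.Exports.
Local Open Scope classical_set_scope.
Local Open Scope ring_scope.

(** * Connectedness criteria and continuity of maps into row vectors *)

Lemma connected_subsingleton (T : topologicalType) (A : set T) :
  (forall x y, A x -> A y -> x = y) -> connected A.
Proof.
move=> A1; have [->|/set0P[x Ax]] := eqVneq A set0; first exact: connected0.
rewrite (_ : A = [set x]); first exact: connected1.
by apply/seteqP; split=> y /= => [/A1|->//]; apply.
Qed.

Lemma connected_bigcup_meet (T : topologicalType) (I : Type) (S : set T)
    (P : set I) (F : I -> set T) :
  connected S -> (forall i, P i -> connected (F i)) ->
  (forall i, P i -> S `&` F i !=set0) ->
  connected (S `|` \bigcup_(i in P) F i).
Proof.
move=> cS cF SF; have [S0|/set0P[c Sc]] := eqVneq S set0.
  rewrite S0 set0U bigcup0; first exact: connected0.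
  by move=> i /SF; rewrite S0 set0I => -[].
have [P0|/set0P[j Pj]] := eqVneq P set0.
  by rewrite P0 bigcup_set0 setU0.
rewrite -bigcupUr; last by exists j.
apply: bigcup_connected; first by exists c => i _; left.
by move=> i Pi; apply: connectedU; [exact: SF|exact: cS|exact: cF].
Qed.

Lemma connected_affine_segment (R : realType) (V : normedModType R) (a b : V) :
  connected [set a + t *: (b - a) | t in `[0, 1]].
Proof.
apply: connected_continuous_connected; first exact: segment_connected.
apply: continuous_subspaceT => t.
by apply: cvgD; [exact: cvg_cst|apply: cvgZ; [exact: cvg_id|exact: cvg_cst]].
Qed.

Lemma connected_star_fibers (R : realType) (T : topologicalType)
    (V : normedModType R) (E : set T) (s : T -> V) (A : set V) :
  connected E -> {within E, continuous s} -> (forall x, E x -> A (s x)) ->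
  (forall z, A z -> exists2 x, E x &
     forall t, 0 <= t <= 1 -> A (s x + t *: (z - s x))) ->
  connected A.
Proof.
move=> cE cs EA Astar.
pose F (p : T * V) := [set s p.1 + t *: (p.2 - s p.1) | t in `[0 : R, 1]].
pose P := [set p : T * V | E p.1 /\ F p `<=` A].
rewrite (_ : A = s @` E `|` \bigcup_(p in P) F p).
  apply: connected_bigcup_meet.
  - exact: connected_continuous_connected.
  - by move=> p _; exact: connected_affine_segment.
  - move=> p [Ep _]; exists (s p.1); split; first by exists p.1.
    by exists 0; rewrite ?scale0r ?addr0//= in_itv/= lexx ler01.
apply/seteqP; split=> [z Az|z [[x Ex <-]|[p [_]]]]; last 2 first.
- exact: EA.
- exact.
have [x Ex xzA] := Astar z Az; right; exists (x, z).
  split=> // _ [t /= t01 <-]; by apply: xzA; rewrite in_itv in t01.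
by exists 1; rewrite /= ?in_itv/= ?ler01 ?lexx// scale1r addrC subrK.
Qed.

Lemma continuous_within_open (T U : topologicalType) (A : set T) (f : T -> U) :
  (forall x, A x -> {for x, continuous f}) -> {within A, continuous f}.
Proof. by move=> cf; apply: continuous_in_subspaceT => x /set_mem /cf. Qed.

Lemma continuous_row (R : realType) (T : topologicalType) (n : nat)
    (f : T -> 'rV[R]_n) (a : T) :
  (forall i, {for a, continuous (fun x => f x 0 i)}) -> {for a, continuous f}.
Proof.
move=> cf A [P /= fP PA].
have : \forall x \near a, forall i : 'I_n, P 0 i (f x 0 i).
  apply: filter_forall => i; exact: cf (fP 0 i).
by apply: filterS => x Px; apply: PA => i j; rewrite (ord1 i).
Qed.

(** * Splitting off the last coordinate *)

Section Coordinates.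
Context {R : realType}.
Implicit Types n : nat.

Lemma rinit_continuous n : continuous (@rinit R n).
Proof.
move=> z; apply: continuous_row => i.
rewrite (_ : (fun _ => _) =
    fun z : 'rV[R]_n.+1 => z 0 (widen_ord (leqnSn n) i)).
  exact: coord_continuous.
by apply/funext => y; rewrite mxE.
Qed.

Lemma rlast_continuous n : continuous (@rlast R n).
Proof. exact: coord_continuous. Qed.

Definition rsnoc n (x : 'rV[R]_n) (y : R) : 'rV[R]_n.+1 :=
  \row_i oapp (x 0) y (unlift ord_max i).

Lemma widen_lift n (i : 'I_n) : widen_ord (leqnSn n) i = lift ord_max i.
Proof. by apply: val_inj; rewrite /= /bump leqNgt ltn_ord. Qed.

Lemma rinit_rsnoc n (x : 'rV[R]_n) y : rinit (rsnoc x y) = x.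
Proof. by apply/rowP => i; rewrite !mxE widen_lift liftK. Qed.

Lemma rlast_rsnoc n (x : 'rV[R]_n) y : rlast (rsnoc x y) = y.
Proof. by rewrite /rlast mxE unlift_none. Qed.

Lemma rsnoc_continuous (T : topologicalType) n (f : T -> 'rV[R]_n)
    (g : T -> R) (a : T) :
  {for a, continuous f} -> {for a, continuous g} ->
  {for a, continuous (fun x => rsnoc (f x) (g x))}.
Proof.
move=> cf cg; apply: continuous_row => i; case: (unliftP ord_max i) => [j|] ij.
  rewrite (_ : (fun _ => _) = fun x => f x 0 j); last first.
    by apply/funext => x; rewrite mxE ij liftK.
  exact: (continuous_comp cf (@coord_continuous _ _ _ _ _ _)).
rewrite (_ : (fun _ => _) = g)//.
by apply/funext => x; rewrite mxE ij unlift_none.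
Qed.

Lemma rinit_affine n (a b : 'rV[R]_n.+1) t :
  rinit (a + t *: (b - a)) = rinit a + t *: (rinit b - rinit a).
Proof. by apply/rowP => i; rewrite !mxE. Qed.

Lemma rlast_affine n (a b : 'rV[R]_n.+1) t :
  rlast (a + t *: (b - a)) = rlast a + t * (rlast b - rlast a).
Proof. by rewrite /rlast !mxE. Qed.

(** The norm of a row is the maximum of the absolute values of its entries, so it dominates the last
    one. *)
Lemma unbounded_rlast n (A : set 'rV[R]_n.+1) :
  (forall M, exists2 z, A z & M < `|rlast z|) -> unbounded A.
Proof.
move=> AM [M [_ /(_ (M + 1))]] /(_ _)/wrap[|AM1]; first by rewrite ltrDl.
have [z Az] := AM (M + 1); rewrite ltNge => /negP; apply.
apply: le_trans (AM1 z Az); rewrite /rlast /Num.norm/= mx_normE.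
exact: (le_bigmax _ (fun i => `|z i.1 i.2|%:nng) (0, ord_max)).
Qed.

End Coordinates.

(** * Continuity of the polynomials and of the graph functions *)

Section NegativeIndex.
Context {R : realType}.
Implicit Types n m k : nat.

Lemma continuous_addl (c : R) : continuous (+%R c).
Proof. by move=> x; apply: cvgD; [exact: cvg_cst|exact: cvg_id]. Qed.

Lemma continuous_mul (T : topologicalType) (f g : T -> R) (a : T) :
  {for a, continuous f} -> {for a, continuous g} ->
  {for a, continuous (fun z => f z * g z)}.
Proof. by move=> cf cg; apply: cvgM. Qed.

Lemma continuous_three_term (T : topologicalType) (f g h : T -> R) (a : T) :
  {for a, continuous f} -> {for a, continuous g} -> {for a, continuous h} ->
  {for a, continuous (fun z => (2 + f z) * g z - h z)}.
Proof.
move=> cf cg ch; apply: cvgB => //; apply: cvgM => //.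
by apply: cvgD => //; exact: cvg_cst.
Qed.

Lemma continuous_div_sub2 (T : topologicalType) (f g : T -> R) (a : T) :
  {for a, continuous f} -> {for a, continuous g} -> g a != 0 ->
  {for a, continuous (fun z => f z / g z - 2)}.
Proof.
move=> cf cg ga; apply: cvgB; last exact: cvg_cst.
by apply: cvgM => //; exact: cvgV.
Qed.

(** The recurrence has order two, so the induction carries two consecutive indices, as do those for
    [idx_le], [D_E], [E_open] and [E_connected]. *)
Lemma Q_continuous n : continuous (@Q R n).
Proof.
suff: continuous (@Q R n) /\ continuous (@Q R n.+1) by case.
elim: n => [|n [IH0 IH1]]; split=> // z.
- exact: cst_continuous.
- apply: (@continuous_comp _ _ _ (fun z : 'rV[R]_1 => z 0 0) (+%R 1)).
    exact: coord_continuous.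
  exact: continuous_addl.
have cx := @rinit_continuous R n.+1 z.
apply: (continuous_three_term (f := @rlast R n.+1) (g := fun z => Q (rinit z))
  (h := fun z => Q (rinit (rinit z)))).
- exact: rlast_continuous.
- by apply: continuous_comp; [exact: cx|exact: IH1].
apply: (@continuous_comp _ _ _ (@rinit R n.+1) (fun x => Q (rinit x))) => //.
by apply: continuous_comp; [exact: rinit_continuous|exact: IH0].
Qed.

(* With the convention Gamma_0^(0) = {-1}, i.e. Phi_0 = -1, the graph of
   Phi_n is the zero set of Q_(n+1) over Dom Phi_n for n = 0 as well. *)
Definition psi n : 'rV[R]_n -> R :=
  match n with 0 => fun=> -1 | m.+1 => pval (Phi R m.+1) end.

Lemma psi_continuous n (x : 'rV[R]_n) : Q x != 0 ->
  {for x, continuous (@psi n)}.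
Proof.
case: n x => [|n] x Qx0; first exact: cst_continuous.
apply: (continuous_div_sub2 (f := fun x => Q (rinit x)) (g := @Q R n.+1)) => //;
  last exact: Q_continuous.
apply: (@continuous_comp _ _ _ (@rinit R n) (@Q R n)).
  exact: rinit_continuous.
exact: Q_continuous.
Qed.

(** * Signs of consecutive polynomials and the count of sign changes *)

Lemma Q_rec n (z : 'rV[R]_n.+2) :
  Q z = (2 + rlast z) * Q (rinit z) - Q (rinit (rinit z)).
Proof. by []. Qed.

Lemma Q_psi n (z : 'rV[R]_n.+1) : Q (rinit z) != 0 ->
  Q z = Q (rinit z) * (rlast z - psi (rinit z)).
Proof.
case: n z => [|n] z Qx0.
  by rewrite /= mul1r opprK addrC /rlast (ord1 ord_max).
rewrite Q_rec -[psi _]/(Q (rinit (rinit z)) / Q (rinit z) - 2).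
by field.
Qed.

(** Only Q_n is factored out, so the formula stays valid where Q_(n+1) vanishes. *)
Lemma Q2_psi n (z : 'rV[R]_n.+2) (w := rinit (rinit z)) : Q w != 0 ->
  Q z = Q w * ((2 + rlast z) * (rlast (rinit z) - psi w) - 1).
Proof. by move=> Qw0; rewrite Q_rec Q_psi// -/w; ring. Qed.

Lemma Q_eq0 n (z : 'rV[R]_n.+1) : Q (rinit z) != 0 ->
  (Q z == 0) = (rlast z == psi (rinit z)).
Proof. by move=> Qx0; rewrite Q_psi// mulf_eq0 (negPf Qx0) subr_eq0. Qed.

Lemma Q_mul_rinit n (z : 'rV[R]_n.+1) : Q (rinit z) != 0 ->
  Q z * Q (rinit z) = Q (rinit z) ^+ 2 * (rlast z - psi (rinit z)).
Proof. by move=> Qx0; rewrite Q_psi//; ring. Qed.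

Lemma Q_gt0 n (z : 'rV[R]_n.+1) : Q (rinit z) != 0 ->
  (0 < Q z * Q (rinit z)) = (psi (rinit z) < rlast z).
Proof.
by move=> Qx0; rewrite Q_mul_rinit// pmulr_rgt0 ?subr_gt0// exprn_even_gt0.
Qed.

Lemma Q_lt0 n (z : 'rV[R]_n.+1) : Q (rinit z) != 0 ->
  (Q z * Q (rinit z) < 0) = (rlast z < psi (rinit z)).
Proof.
by move=> Qx0; rewrite Q_mul_rinit// pmulr_rlt0 ?subr_lt0// exprn_even_gt0.
Qed.

Lemma Q2_lt0 n (z : 'rV[R]_n.+2) (w := rinit (rinit z)) : Q w != 0 ->
  (Q z * Q w < 0) = ((2 + rlast z) * (rlast (rinit z) - psi w) < 1).
Proof.
move=> Qw0; rewrite Q2_psi// -/w mulrAC -expr2 pmulr_rlt0 ?subr_lt0//.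
by rewrite exprn_even_gt0.
Qed.

(* The number of sign changes in Q_0, ..., Q_n, an isolated zero between
   values of opposite signs counting for one. It is the number of negative
   eigenvalues of the Jacobi matrix whose leading minors are the Q_i. *)
Fixpoint idx n : 'rV[R]_n -> nat :=
  match n return 'rV[R]_n -> nat with
  | 0 => fun=> 0
  | m.+1 => fun z =>
      if Q (rinit z) == 0 then
        match m return 'rV[R]_m -> nat with
        | 0 => fun=> 0
        | p.+1 => fun x => (@idx p (rinit x)).+1
        end (rinit z)
      else (@idx m (rinit z) + (Q z * Q (rinit z) < 0)%R)%N
  end.

Lemma idx_rinit n (z : 'rV[R]_n.+1) : Q (rinit z) != 0 ->
  idx z = (idx (rinit z) + (Q z * Q (rinit z) < 0)%R)%N.
Proof. by move=> Qx0; rewrite /= (negPf Qx0). Qed.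

Lemma idx_rinit0 n (z : 'rV[R]_n.+2) : Q (rinit z) = 0 ->
  idx z = (idx (rinit (rinit z))).+1.
Proof. by move=> Qx0; rewrite [LHS]/= ifT//; exact/eqP. Qed.

(** When Q_(n+1) is nonzero, the products Q_(n+2) Q_(n+1) and Q_(n+1) Q_n multiply to Q_(n+1)^2
    Q_(n+2) Q_n < 0, so exactly one of them is negative. *)
Lemma idx_rinit2 n (z : 'rV[R]_n.+2) (w := rinit (rinit z)) :
  Q z * Q w < 0 -> idx z = (idx w).+1.
Proof.
move=> Qzw; have Qw0 : Q w != 0.
  by apply: contraTneq Qzw => ->; rewrite mulr0 ltxx.
have [Qx0|Qx0] := eqVneq (Q (rinit z)) 0; first exact: idx_rinit0.
rewrite idx_rinit// [idx (rinit z)]idx_rinit// -/w -addnA -[RHS]addn1.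
congr addn.
have : Q z * Q (rinit z) * (Q (rinit z) * Q w) < 0.
  rewrite (_ : _ * _ = Q (rinit z) ^+ 2 * (Q z * Q w)); last by ring.
  by rewrite pmulr_rlt0// exprn_even_gt0.
case: (ltgtP (Q (rinit z) * Q w) 0) => [xw|xw|->]; last by rewrite mulr0 ltxx.
  by rewrite nmulr_llt0// => /lt_gtF ->.
by rewrite pmulr_llt0// => ->.
Qed.

Lemma idx_le n (z : 'rV[R]_n) : (idx z <= n)%N.
Proof.
suff: (forall z : 'rV[R]_n, idx z <= n)%N /\
    (forall z : 'rV[R]_n.+1, idx z <= n.+1)%N.
  by case.
elim: n {z} => [|n [IH0 IH1]]; split=> // z.
  by rewrite /=; case: ifP => // _; rewrite add0n leq_b1.
have [Qx0|Qx0] := eqVneq (Q (rinit z)) 0.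
  by rewrite idx_rinit0// ltnS leqW.
by rewrite idx_rinit// (leq_trans (leq_add (IH1 _) (leq_b1 _)))// addn1.
Qed.

(** * Classes with a given number of sign changes *)

(** For n = 0 the class of index 0 is the one-point space, whereas [D R 0 k] is empty; the two
    families agree from n = 1 on. *)
Definition E n k : set 'rV[R]_n := [set z | Q z != 0 /\ idx z = k].

Lemma E_lift n (z : 'rV[R]_n.+1) k (b : bool) : E k (rinit z) ->
  (if b then rlast z < psi (rinit z) else psi (rinit z) < rlast z) ->
  E (k + b) z.
Proof.
move=> [Qx0 <-] zb; split.
  by rewrite Q_eq0//; case: b zb => [/lt_eqF|/gt_eqF] ->.
rewrite idx_rinit// Q_lt0//; case: b zb => [->//|].
by move=> /lt_gtF ->.
Qed.

Lemma E_lift2 n (z : 'rV[R]_n.+2) k (w := rinit (rinit z)) : E k w ->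
  (2 + rlast z) * (rlast (rinit z) - psi w) < 1 -> E k.+1 z.
Proof.
move=> [Qw0 <-]; rewrite -Q2_lt0// => Qzw; split; last exact: idx_rinit2.
by apply: contraTneq Qzw => ->; rewrite mul0r ltxx.
Qed.

Lemma E_inv n (z : 'rV[R]_n.+1) k : E k z -> Q (rinit z) != 0 ->
  exists j (b : bool), [/\ k = (j + b)%N, E j (rinit z) &
    if b then rlast z < psi (rinit z) else psi (rinit z) < rlast z].
Proof.
move=> [Qz0 zk] Qx0; exists (idx (rinit z)), (rlast z < psi (rinit z)).
rewrite -Q_lt0// -zk -idx_rinit//; split => //; rewrite Q_lt0//.
by move: Qz0; rewrite Q_eq0//; case: ltgtP.
Qed.

Lemma E_rinit0 n (z : 'rV[R]_n.+2) k : E k z -> Q (rinit z) = 0 ->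
  exists2 j, k = j.+1 & E j (rinit (rinit z)).
Proof.
move=> [Qz0 <-] Qx0; exists (idx (rinit (rinit z))); first exact: idx_rinit0.
by split=> //; move: Qz0; rewrite Q_rec Qx0 mulr0 sub0r oppr_eq0.
Qed.

Lemma E_gt n k (z : 'rV[R]_n) : (n < k)%N -> ~ E k z.
Proof. by move=> nk [_ zk]; move: (idx_le z); rewrite zk leqNgt nk. Qed.

(** A vanishing previous polynomial would contribute a sign change, and Q_0 = 1 never vanishes. *)
Lemma E_0 n (z : 'rV[R]_n.+1) :
  E 0 z <-> E 0 (rinit z) /\ psi (rinit z) < rlast z.
Proof.
split=> [Ez|[Ex xz]]; last exact: (E_lift (b := false) Ex).
have [Qx0|Qx0] := eqVneq (Q (rinit z)) 0; last first.
  by have [[|j] [[|] []]] := E_inv Ez Qx0.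
case: n z Ez Qx0 => [|n] z Ez Qx0; last by have [] := E_rinit0 Ez Qx0.
by move: Qx0 => /eqP; rewrite /= oner_eq0.
Qed.

Lemma E_S n (z : 'rV[R]_n.+2) k : E k.+1 z <->
  (E k (rinit z) /\ rlast z < psi (rinit z) \/
   E k (rinit (rinit z)) /\ Q (rinit z) = 0) \/
  E k.+1 (rinit z) /\ psi (rinit z) < rlast z.
Proof.
split=> [Ez|[[[Ex zx]|[[Qw0 wk] Qx0]]|[Ex xz]]].
- have [Qx0|Qx0] := eqVneq (Q (rinit z)) 0.
    by have [_ [<-] Ew] := E_rinit0 Ez Qx0; left; right.
  have [j [[|] [+ Ex zx]]] := E_inv Ez Qx0.
    by rewrite addn1 => -[->]; left; left.
  by rewrite addn0 => ->; right.
- by have := E_lift (b := true) Ex zx; rewrite addn1.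
- by split; rewrite ?idx_rinit0 ?wk// Q_rec Qx0 mulr0 sub0r oppr_eq0.
- by have := E_lift (b := false) Ex xz; rewrite addn0.
Qed.

(** * Identification of the inductive sets with the sign-change classes *)

Lemma epi_PhiE n k : epi (prestrict (Phi R n.+1) (E k)) =
  [set z | E k (rinit z) /\ psi (rinit z) < rlast z].
Proof. by apply/seteqP; split=> z [] => [[_ ?]|[]]. Qed.

Lemma hypo_PhiE n k : hypo (prestrict (Phi R n.+1) (E k)) =
  [set z | E k (rinit z) /\ rlast z < psi (rinit z)].
Proof. by apply/seteqP; split=> z [] => [[_ ?]|[]]. Qed.

(** For n = 0 the convention {-1} is the zero set of Q_1 = 1 + mu_1; for n >= 1 the graph is a zero
    set by [Q_eq0]. *)
Lemma GammaE n k : (0 < n -> D R n = @E n)%N ->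
  Gamma_of (D R n) k = [set x | E k (rinit x) /\ Q x = 0].
Proof.
case: n => [_|n /(_ isT) DE]; apply/seteqP; split=> x.
- case: k => [/=|//] ->; rewrite /E/= subrr; do !split=> //.
- by move=> [[_ <-]] /= /eqP; rewrite addrC addr_eq0 => /eqP.
- rewrite DE => -[[Qx0 Ex] /eqP xE]; split=> //; apply/eqP.
  by rewrite Q_eq0.
- move=> [Ex /eqP]; have [Qx0 _] := Ex.
  by rewrite Q_eq0// DE => /eqP.
Qed.

Lemma D_rec n k : D R n.+2 k =
  if k == 0%N then epi (prestrict (Phi R n.+1) (D R n.+1 0%N))
  else if (k <= n.+1)%N then
    hypo (prestrict (Phi R n.+1) (D R n.+1 k.-1))
    `|` cylinder (Gamma_of (D R n) k.-1)
    `|` epi (prestrict (Phi R n.+1) (D R n.+1 k))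
  else if k == n.+2 then hypo (prestrict (Phi R n.+1) (D R n.+1 n.+1))
  else set0.
Proof. by []. Qed.

Lemma D_1 : D R 1 = @E 1.
Proof.
have Q1 (z : 'rV[R]_1) : Q (rinit z) != 0 by exact: oner_neq0.
apply/funext => -[|[|k]]; apply/seteqP; split=> z.
- by move=> /= z1; apply/E_0; rewrite /rlast (ord1 ord_max).
- by move=> /E_0[_]; rewrite /rlast (ord1 ord_max).
- move=> /= z1; apply: (@E_lift _ _ 0 true).
    by split=> //; exact: oner_neq0.
  by rewrite /rlast (ord1 ord_max).
- move=> Ez; have [j [[|] [+ [_ jE]]]] := E_inv Ez (Q1 z); rewrite -jE//.
  by rewrite /rlast (ord1 ord_max).
- by [].
- by move=> /E_gt; exact.
Qed.

Lemma D_E n : D R n.+1 = @E n.+1.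
Proof.
suff: (0 < n -> D R n = @E n)%N /\ D R n.+1 = @E n.+1 by case.
elim: n => [|n [IH0 IH1]]; split=> //; first exact: D_1.
apply/funext => k; apply/seteqP; rewrite D_rec IH1 !epi_PhiE !hypo_PhiE.
rewrite GammaE//; case: k => [|k]; first by split=> z /E_0.
rewrite [_ == 0%N]/=; have [kn|nk] := ltnP k n.+1.
  by split=> z; [move=> ?; apply/E_S|move/E_S].
have [[->]|kn] := eqVneq k.+1 n.+2.
  split=> z; first by move=> ?; apply/E_S; left; left.
  (* At the top index the cylinder and the epigraph lie over classes whose index exceeds the
     dimension, hence over empty sets. *)
  by move=> /E_S[[//|[/E_gt]]|[/E_gt]]; case.
split=> z // Ez; apply: (@E_gt n.+2 k.+1 z) => //.
by rewrite ltn_neqAle eq_sym kn.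
Qed.

(** * Openness of the classes *)

Lemma Q_mul_rinit_continuous n :
  continuous (fun z : 'rV[R]_n.+1 => Q z * Q (rinit z)).
Proof.
move=> z; apply: continuous_mul; first exact: Q_continuous.
apply: (@continuous_comp _ _ _ (@rinit R n) (@Q R n)).
  exact: rinit_continuous.
exact: Q_continuous.
Qed.

Lemma Q_mul_rinit2_continuous n :
  continuous (fun z : 'rV[R]_n.+2 => Q z * Q (rinit (rinit z))).
Proof.
move=> z; apply: continuous_mul; first exact: Q_continuous.
apply: (@continuous_comp _ _ _ (@rinit R n.+1) (fun x => Q (rinit x))).
  exact: rinit_continuous.
apply: (@continuous_comp _ _ _ (@rinit R n) (@Q R n)).
  exact: rinit_continuous.
exact: Q_continuous.
Qed.

(** The side of the graph is read off the sign of Q_(n+1) Q_n, which is continuous everywhere,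
    unlike [psi]. *)
Lemma E_nbhs_rinit n (z : 'rV[R]_n.+1) k : (forall j, open (@E n j)) ->
  E k z -> Q (rinit z) != 0 -> nbhs z (E k).
Proof.
move=> oE Ez Qx0; have [j [b [-> Ex zb]]] := E_inv Ez Qx0.
have Exz : \forall y \near z, E j (rinit y).
  exact: (@rinit_continuous R n z) (open_nbhs_nbhs (conj (oE j) Ex)).
have Qzc := @Q_mul_rinit_continuous n z.
case: b zb => zb; [move: zb; rewrite -Q_lt0//|move: zb; rewrite -Q_gt0//] => zb.
- have Qy : \forall y \near z, Q y * Q (rinit y) < 0 by exact: (cvgr_lt _ Qzc).
  move: Exz Qy; apply: filterS2 => y Ey.
  by rewrite Q_lt0; [exact: (E_lift (b := true) Ey)|case: Ey].
- have Qy : \forall y \near z, 0 < Q y * Q (rinit y) by exact: (cvgr_gt _ Qzc).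
  move: Exz Qy; apply: filterS2 => y Ey.
  by rewrite Q_gt0; [exact: (E_lift (b := false) Ey)|case: Ey].
Qed.

(** At such a point Q_(n+2) Q_n = - Q_n^2 < 0. This persists nearby, and there the index depends
    only on the first n coordinates. *)
Lemma E_nbhs_rinit2 n (z : 'rV[R]_n.+2) k : (forall j, open (@E n j)) ->
  E k z -> Q (rinit z) = 0 -> nbhs z (E k).
Proof.
move=> oE Ez Qx0; have [j -> Ew] := E_rinit0 Ez Qx0.
have Ewz : \forall y \near z, E j (rinit (rinit y)).
  have : \forall x \near rinit z, E j (rinit x).
    exact: (@rinit_continuous R n (rinit z)) (open_nbhs_nbhs (conj (oE j) Ew)).
  exact: (@rinit_continuous R n.+1 z).
have zw : Q z * Q (rinit (rinit z)) < 0.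
  rewrite Q_rec Qx0 mulr0 sub0r mulNr oppr_lt0 -expr2 exprn_even_gt0//.
  by case: Ew.
have Qy : \forall y \near z, Q y * Q (rinit (rinit y)) < 0.
  exact: (cvgr_lt _ (@Q_mul_rinit2_continuous n z)).
move: Ewz Qy; apply: filterS2 => y Ey.
by rewrite Q2_lt0; [exact: E_lift2|case: Ey].
Qed.

Lemma E_open n k : open (@E n k).
Proof.
suff: (forall k, open (@E n k)) /\ forall k, open (@E n.+1 k) by case.
elim: n {k} => [|n [IH0 IH1]]; split=> // k.
- rewrite openE => z Ez; apply: filterS filterT => y _.
  by rewrite (_ : y = z)//; apply/rowP => -[].
- rewrite openE => z Ez; apply: E_nbhs_rinit => //; last exact: oner_neq0.
  move=> j; rewrite openE => x Ex; apply: filterS filterT => y _.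
  by rewrite (_ : y = x)//; apply/rowP => -[].
rewrite openE => z Ez; have [Qx0|Qx0] := eqVneq (Q (rinit z)) 0.
  exact: E_nbhs_rinit2.
exact: E_nbhs_rinit.
Qed.

(** * Nonemptiness and unboundedness *)

Lemma E_rsnoc_lt n (x : 'rV[R]_n) k (y : R) :
  E k x -> y < psi x -> E k.+1 (rsnoc x y).
Proof.
move=> Ex yx; have := @E_lift n (rsnoc x y) k true.
by rewrite addn1 rinit_rsnoc rlast_rsnoc; apply.
Qed.

Lemma E_rsnoc_gt n (x : 'rV[R]_n) k (y : R) :
  E k x -> psi x < y -> E k (rsnoc x y).
Proof.
move=> Ex xy; have := @E_lift n (rsnoc x y) k false.
by rewrite addn0 rinit_rsnoc rlast_rsnoc; apply.
Qed.

Lemma E_nonempty n k : (k <= n)%N -> @E n k !=set0.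
Proof.
elim: n k => [[|//] _|n IH k]; first by exists 0; split=> //; exact: oner_neq0.
rewrite leq_eqVlt => /predU1P[->|/IH[x Ex]].
  have [x Ex] := IH n (leqnn n); exists (rsnoc x (psi x - 1)).
  by apply: E_rsnoc_lt => //; rewrite gtrBl.
exists (rsnoc x (psi x + 1)).
by apply: E_rsnoc_gt => //; rewrite ltrDl.
Qed.

(** The class contains a vertical half-line: below the graph over a point of index n if k = n + 1,
    above it over a point of index k otherwise. *)
Lemma E_unbounded n k : (k <= n.+1)%N -> unbounded (@E n.+1 k).
Proof.
rewrite leq_eqVlt => /predU1P[->|]; [|rewrite ltnS => /E_nonempty[x Ex]];
    apply: unbounded_rlast => M.
  have [x Ex] := E_nonempty (leqnn n).
  exists (rsnoc x (- (`|psi x| + `|M| + 1))).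
    apply: E_rsnoc_lt => //.
    have := ler_norm (- psi x); rewrite normrN; have := normr_ge0 M; lra.
  rewrite rlast_rsnoc normrN ger0_norm; have := normr_ge0 (psi x);
    have := ler_norm M; have := normr_ge0 M; lra.
exists (rsnoc x (`|psi x| + `|M| + 1)).
  apply: E_rsnoc_gt => //.
  have := ler_norm (psi x); have := normr_ge0 M; lra.
rewrite rlast_rsnoc ger0_norm; have := normr_ge0 (psi x);
  have := ler_norm M; have := normr_ge0 M; lra.
Qed.

(** * Connectedness of the classes *)

(** The sign of [e] selects the epigraph (positive) or the hypograph (negative), so one argument
    serves both. *)
Definition halfcyl n k (e : R) : set 'rV[R]_n.+1 :=
  [set z | E k (rinit z) /\ 0 < e * (rlast z - psi (rinit z))].

Lemma connected_halfcyl n k e : e != 0 -> connected (@E n k) ->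
  connected (@halfcyl n k e).
Proof.
move=> e0 cE.
(* The section at height [e] off the graph is on the correct side for either sign, since e * e >
   0. *)
apply: (connected_star_fibers (s := fun x => rsnoc x (e + psi x)) cE).
- apply: continuous_within_open => x [Qx0 _].
  apply: rsnoc_continuous; first exact: cvg_id.
  apply: (@continuous_comp _ _ _ (@psi n) (+%R e)).
    exact: psi_continuous.
  exact: continuous_addl.
- move=> x Ex; rewrite /halfcyl/= rinit_rsnoc rlast_rsnoc; split=> //.
  by rewrite addrK -expr2 exprn_even_gt0.
move=> z [Ez ez]; exists (rinit z) => // t /andP[t0 t1]; rewrite /halfcyl/=.
rewrite rinit_affine rlast_affine rinit_rsnoc rlast_rsnoc subrr scaler0 addr0.
split=> //; have e2 : 0 < e ^+ 2 by rewrite exprn_even_gt0.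
rewrite (_ : _ * _ = (1 - t) * e ^+ 2 + t * (e * (rlast z - psi (rinit z))));
  last by ring.
have [->|tn0] := eqVneq t 0; first by rewrite subr0 mul1r mul0r addr0.
apply: ltr_wpDl; first by rewrite mulr_ge0 ?subr_ge0// ltW.
by rewrite mulr_gt0// lt0r tn0.
Qed.

(* In the coordinates u = z_(n+1) - Phi_n and v = z_(n+2) + 2 the fibres are the
   planar sets u v < 1, which are star-shaped about the origin. *)
Definition bridge n k : set 'rV[R]_n.+2 :=
  [set z | E k (rinit (rinit z)) /\
    (2 + rlast z) * (rlast (rinit z) - psi (rinit (rinit z))) < 1].

(** The section [s] is the origin u = v = 0 of each fibre; along the segment from it the product u v
    is scaled by t^2 <= 1. *)
Lemma connected_bridge n k : connected (@E n k) -> connected (@bridge n k).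
Proof.
move=> cE; pose s (w : 'rV[R]_n) := rsnoc (rsnoc w (psi w)) (- 2).
apply: (connected_star_fibers (s := s) cE).
- apply: continuous_within_open => w [Qw0 _].
  apply: (rsnoc_continuous (f := fun w => rsnoc w (psi w)) (g := fun=> - 2)).
    by apply: rsnoc_continuous; [exact: cvg_id|exact: psi_continuous].
  exact: cst_continuous.
- move=> w Ew; rewrite /bridge/= !(rinit_rsnoc, rlast_rsnoc); split=> //.
  by rewrite subrr mul0r.
move=> z [Ew uv]; set w := rinit (rinit z) in Ew uv.
exists w => // t /andP[t0 t1]; rewrite /bridge/= !(rinit_affine, rlast_affine).
rewrite !(rinit_rsnoc, rlast_rsnoc) -/w subrr scaler0 addr0; split=> //.
rewrite (_ : _ * _ = t ^+ 2 * ((2 + rlast z) * (rlast (rinit z) - psi w)));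
  last by ring.
have [uv0|/ltW uv0] := leP ((2 + rlast z) * (rlast (rinit z) - psi w)) 0.
  by rewrite (le_lt_trans _ ltr01)// mulr_ge0_le0// exprn_ge0.
by apply: le_lt_trans uv; rewrite ler_piMl// exprn_ile1.
Qed.

(** The joining cylinder is the part u = 0 of the bridge, and by [E_lift2] the whole bridge has
    index k + 1; so the cylinder may be thickened to it. *)
Lemma E_S_bridge n k :
  @E n.+2 k.+1 = halfcyl k (- 1) `|` bridge k `|` halfcyl k.+1 1.
Proof.
apply/seteqP; split=> z.
  move=> /E_S[[[Ex zx]|[Ew Qx0]]|[Ex xz]].
  - by left; left; split=> //; rewrite mulN1r opprB subr_gt0.
  - left; right; split=> //; case: (Ew) => Qw0 _.
    by move/eqP: Qx0; rewrite Q_eq0// => /eqP ->; rewrite subrr mulr0.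
  - by right; split=> //; rewrite mul1r subr_gt0.
move=> [[[Ex]|[Ew /(E_lift2 Ew)//]]|[Ex]].
- by rewrite mulN1r opprB subr_gt0 => zx; apply/E_S; left; left.
- by rewrite mul1r subr_gt0 => xz; apply/E_S; right.
Qed.

(** The other pieces lie over empty classes; for k > n both sides are empty. *)
Lemma E_S_top n k : (n <= k)%N -> @E n.+1 k.+1 = halfcyl k (- 1).
Proof.
move=> nk; apply/seteqP; split=> z; rewrite /halfcyl/= mulN1r opprB subr_gt0.
  move=> Ez; have [Qx0|Qx0] := eqVneq (Q (rinit z)) 0; last first.
    have [j [[|] [+ Ex zx]]] := E_inv Ez Qx0; first by rewrite addn1 => -[->].
    by rewrite addn0 => kj; case: (E_gt _ Ex); rewrite -kj ltnS.
  case: n nk z Ez Qx0 => [|n] nk z Ez Qx0.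
    by move/eqP: Qx0; rewrite oner_eq0.
  by have [j [<-] /E_gt] := E_rinit0 Ez Qx0; case.
by move=> [Ex zx]; have := E_lift (b := true) Ex zx; rewrite addn1.
Qed.

Lemma bridge_meets_halfcyl n k (w : 'rV[R]_n) : E k w ->
  halfcyl k (- 1) `&` @bridge n k !=set0 /\
  (halfcyl k (- 1) `|` @bridge n k) `&` halfcyl k.+1 1 !=set0.
Proof.
move=> Ew; have [Qw0 _] := Ew; have Qw2 : 0 < Q w ^+ 2.
  by rewrite exprn_even_gt0.
have Q1 e : Q (rsnoc w (psi w + e)) = Q w * e.
  by rewrite Q_psi rinit_rsnoc// rlast_rsnoc (addrC (psi w)) addrK.
have Q2 e y : Q (rsnoc (rsnoc w (psi w + e)) y) = Q w * ((2 + y) * e - 1).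
  by rewrite Q2_psi !(rinit_rsnoc, rlast_rsnoc)// (addrC (psi w)) addrK.
split.
  (* Here u = 1 and v = 0, giving Q_(n+1) = Q_n and Q_(n+2) = - Q_n. *)
  pose x := rsnoc w (psi w + 1); exists (rsnoc x (- 2)); split.
    rewrite /halfcyl/= rinit_rsnoc mulN1r opprB subr_gt0; split.
      by apply: E_rsnoc_gt; rewrite ?ltrDl.
    have := @Q_lt0 _ (rsnoc x (- 2)); rewrite rinit_rsnoc => <-.
      by rewrite Q1 Q2 subrr mul0r sub0r mulr1 mulrN1 mulNr oppr_lt0 -expr2.
    by rewrite Q1 mulr1.
  by rewrite /bridge/= !(rinit_rsnoc, rlast_rsnoc) subrr mul0r.
(* Here u = -1 and v = 2, giving Q_(n+1) = - Q_n and Q_(n+2) = - 3 Q_n. *)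
pose x := rsnoc w (psi w + - 1); exists (rsnoc x 0); split.
  right; rewrite /bridge/= !(rinit_rsnoc, rlast_rsnoc); split=> //.
  by rewrite addr0 (addrC (psi w)) addrK mulrN1 (lt_trans _ ltr01)// oppr_lt0.
rewrite /halfcyl/= rinit_rsnoc mul1r subr_gt0; split.
  by apply: E_rsnoc_lt; rewrite ?gtrBl.
have := @Q_gt0 _ (rsnoc x 0); rewrite rinit_rsnoc => <-.
  rewrite Q1 Q2 (_ : _ * _ = 3 * Q w ^+ 2); first by rewrite mulr_gt0.
  by ring.
by rewrite Q1 mulrN1 oppr_eq0.
Qed.

Lemma E_connected n k : connected (@E n k).
Proof.
suff: (forall k, connected (@E n k)) /\ forall k, connected (@E n.+1 k).
  by case.
have half n' k' e : connected (@E n' k') -> e != 0 ->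
    connected (@halfcyl n' k' e) by move=> ? ?; exact: connected_halfcyl.
have E0S n' : connected (@E n' 0) -> connected (@E n'.+1 0).
  move=> cE; rewrite (_ : E 0 = @halfcyl n' 0 1); first exact: half.
  by apply/seteqP; split=> z; rewrite /halfcyl/= mul1r subr_gt0 => /E_0.
have N10 : - 1 != 0 :> R by rewrite oppr_eq0 oner_eq0.
have E00 j : connected (@E 0 j).
  by apply: connected_subsingleton => x y _ _; apply/rowP => -[].
elim: n {k} => [|n [IH0 IH1]]; split=> // -[|k].
- exact: E0S.
- by rewrite E_S_top//; exact: half.
- exact: E0S.
(* For k <= n the class [E k] in dimension n has a point, over which the bridge meets both
   half-cylinders. *)
have [nk|] := ltnP n k; first by rewrite E_S_top//; exact: half.
move=> /E_nonempty[w /bridge_meets_halfcyl[meet1 meet2]].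
rewrite E_S_bridge; apply: connectedU => //; last exact: half.
by apply: connectedU => //; [exact: half|exact: connected_bridge].
Qed.

End NegativeIndex.

(** * Components of a disjoint union of open connected sets, and the conclusion *)

Lemma connected_components_open_partition (T : topologicalType) (I : Type)
    (K : set I) (F : I -> set T) :
  (forall i, K i -> open (F i)) -> (forall i, K i -> connected (F i)) ->
  (forall i, K i -> F i !=set0) -> trivIset K F ->
  connected_components (\bigcup_(i in K) F i) = F @` K.
Proof.
move=> oF cF F0 tF; set A := \bigcup_(i in K) F i.
have compF i x : K i -> F i x -> connected_component A x = F i.
  move=> Ki Fx; apply/seteqP; split; last first.
    by apply: connected_component_max => // [y Fy|]; [exists i|exact: cF].
  pose C := connected_component A x.
  have CA : C `<=` A by exact: connected_component_sub.
  rewrite -/C (_ : C = C `&` F i); first exact: subIsetr.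
  apply/esym/(@component_connected _ A x).
  - by exists x; split=> //; apply: connected_component_refl; exists i.
  - by exists (F i) => //; exact: oF.
  (* Within the union, [F i] is also closed: it is the complement of the union of the other members,
     which is open. *)
  exists (~` \bigcup_(j in K `\ i) F j).
    by apply: open_closedC; apply: bigcup_open => j [Kj _]; exact: oF.
  apply/seteqP; split=> y [Cy].
    move=> Fy; split=> // -[j [Kj /= ji] Fjy]; apply: ji.
    by apply: tF => //; exists y.
  move=> nFy; split=> //; have [j Kj Fjy] := CA y Cy.
  have [<-//|ji] := pselect (j = i).
  by exfalso; apply: nFy; exists j.
apply/seteqP; split=> [_ [x [i Ki Fx] <-]|_ [i Ki <-]].
  by exists i => //; rewrite (compF i).
by have [x Fx] := F0 i Ki; exists x; [exists i|exact: compF].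
Qed.

Theorem theorem4p1 (R : realType) (n : nat) (hn : (1 <= n)%N) :
  [/\ pdom (Phi R n) = \bigcup_(k in [set k | (k <= n)%N]) D R n k,
      connected_components (pdom (Phi R n)) =
        D R n @` [set k | (k <= n)%N],
      (forall k l : nat, (k <= n)%N -> (l <= n)%N -> k <> l ->
         D R n k <> D R n l) &
      (forall k : nat, (k <= n)%N -> unbounded (D R n k))].
Proof.
case: n hn => [//|n] _; rewrite D_E.
have domE : pdom (Phi R n.+1) =
    \bigcup_(k in [set k | (k <= n.+1)%N]) @E R n.+1 k.
  apply/seteqP; split=> [z Qz0|z [k _ []]//].
  by exists (idx z) => //; exact: idx_le.
split=> //.
- rewrite domE; apply: (connected_components_open_partition (F := @E R n.+1)).
  + by move=> k _; exact: E_open.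
  + by move=> k _; exact: E_connected.
  + by move=> k; exact: E_nonempty.
  + by move=> k l _ _ [z [[_ <-] [_ <-]]].
- move=> k l kn _ kl EE; have [z Ez] := @E_nonempty R _ _ kn; apply: kl.
  by move: (Ez); rewrite EE; case: Ez => _ <- [_ <-].
- by move=> k; exact: E_unbounded.
Qed.
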